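(* Let $0<\alpha<1$, let $0=t_0<t_1<\cdots<t_N=T$ be (possibly nonuniform) time levels with $\tau_n:=t_n-t_{n-1}$, and let $A^{(n)}_{j}$ ($0\le j\le n-1$, $1\le n\le N$) be real numbers such that: (A1) $A^{(n)}_0\ge A^{(n)}_1\ge\cdots\ge A^{(n)}_{n-1}>0$ for $1\le n\le N$; (A2) there is a constant $\pi_A>0$ with $A^{(n)}_{n-k}\ge\frac{1}{\pi_A\tau_k}\int_{t_{k-1}}^{t_k}\omega_{1-\alpha}(t_n-s)\,\mathrm{d}s$ for $1\le k\le n\le N$; (A3) there is a constant $\rho>0$ with $\tau_k/\tau_{k+1}\le\rho$ for $1\le k\le N-1$. Let $P^{(n)}_{j}$ be the complementary discrete kernels of the $A^{(n)}_j$. Let $0\le\theta<1$, and let $(g^n)_{n=1}^N$ and $(\lambda_l)_{l=0}^{N-1}$ be given non-negative sequences. Assume further that there exists a constant $\Lambda$ (independent of the step sizes) such that $\Lambda\ge\sum_{l=0}^{N-1}\lambda_l$, and that the maximum step size satisfies $$\max_{1\le n\le N}\tau_n\le\frac{1}{\sqrt[\alpha]{2\pi_A\Gamma(2-\alpha)\Lambda}}.$$ Then, for any non-negative sequence $(v^k)_{k=0}^N$ such that $$\sum_{k=1}^nA^{(n)}_{n-k}\Big((v^k)^2-(v^{k-1})^2\Big)\le\sum_{k=1}^n\lambda_{n-k}\big(v^{k-\theta}\big)^2+v^{n-\theta}g^n\quad\text{for }1\le n\le N,$$ it holds that $$v^n\le2E_\alpha\big(2\max(1,\rho)\pi_A\Lambda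 t_n^\alpha\big)\biggl(v^0+\max_{1\le k\le n}\sum_{j=1}^kP^{(k)}_{k-j}g^j\biggr)\quad\text{for }1\le n\le N.$$
   Context: For $\beta>0$ and $t>0$, $\omega_\beta(t):=t^{\beta-1}/\Gamma(\beta)$. The Mittag--Leffler function is $E_\alpha(z):=\sum_{k=0}^\infty\frac{z^k}{\Gamma(1+k\alpha)}$. For a sequence $(v^k)$, $v^{k-\theta}:=\theta v^{k-1}+(1-\theta)v^k$. If $\Lambda=0$, the right-hand side of the step size restriction is read as $+\infty$ (no restriction). The complementary discrete kernels $P^{(n)}_j$ ($0\le j\le n-1$, $1\le n\le N$) are defined by the recursion $$P^{(n)}_0:=\frac{1}{A^{(n)}_0},\qquad P^{(n)}_j:=\frac{1}{A^{(n-j)}_0}\sum_{k=0}^{j-1}\Big(A^{(n-k)}_{j-k-1}-A^{(n-k)}_{j-k}\Big)P^{(n)}_k\quad\text{for }1\le j\le n-1;$$ equivalently, they are determined by $\sum_{j=m}^nP^{(n)}_{n-j}A^{(j)}_{j-m}=1$ for $1\le m\le n\le N$. *)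

(* Defs.v *)
From HB Require Import structures.
From mathcomp Require Import all_boot all_order all_algebra.
From mathcomp Require Import all_classical all_reals all_analysis.

Set Implicit Arguments.
Unset Strict Implicit.
Unset Printing Implicit Defensive.

Import Order.TTheory GRing.Theory Num.Theory.
Import numFieldNormedType.Exports.

Local Open Scope classical_set_scope.
Local Open Scope ring_scope.

(* Euler's Gamma function, meaningful for 0 < x, where the integral is finite. *)
Definition Gamma {R : realType} (x : R) : R :=
  \int[@lebesgue_measure R]_(s in `]0, +oo[) (s `^ (x - 1) * expR (- s)).

Definition omega {R : realType} (beta t : R) : R :=
  t `^ (beta - 1) / Gamma beta.

Definition mittag_leffler {R : realType} (alpha z : R) : R :=
  limn (series (fun k : nat => z ^+ k / Gamma (1 + k%:R * alpha))).

(* Finite sequences are total functions on nat, of which only the values at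
   the indices mentioned in the hypotheses matter. *)

Definition step {R : realType} (t : nat -> R) (n : nat) : R := t n - t n.-1.

Definition offset {R : realType} (theta : R) (v : nat -> R) (k : nat) : R :=
  theta * v k.-1 + (1 - theta) * v k.

(* For n >= 1, F 1 is one of the terms, so this is the maximum of
   F 1, ..., F n whatever their signs. *)
Definition max_1_to {R : realType} (n : nat) (F : nat -> R) : R :=
  \big[Num.max/F 1%N]_(1 <= k < n.+1) F k.

(* [:: P^(n)_0; ...; P^(n)_j], where A n j stands for A^(n)_j. *)
Fixpoint compl_kernels {R : realType} (A : nat -> nat -> R) (n j : nat)
    : seq R :=
  if j is i.+1 then
    let s := compl_kernels A n i in
    rcons s (1 / A (n - j)%N 0%N *
      \sum_(0 <= k < j) (A (n - k)%N (j - k - 1)%N - A (n - k)%N (j - k)%N)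
                        * s`_k)
  else [:: 1 / A n 0%N].

Definition compl_kernel {R : realType} (A : nat -> nat -> R) (n j : nat) : R :=
  (compl_kernels A n j)`_j.

Lemma size_compl_kernels {R : realType} (A : nat -> nat -> R) (n j : nat) :
  size (compl_kernels A n j) = j.+1.
Proof. by elim: j => //= j IH; rewrite size_rcons IH. Qed.

Lemma nth_compl_kernels {R : realType} (A : nat -> nat -> R) (n j k : nat) :
  (k <= j)%N -> (compl_kernels A n j)`_k = compl_kernel A n k.
Proof.
elim: j => [|j IH]; first by rewrite leqn0 => /eqP ->.
rewrite leq_eqVlt => /predU1P[->//|kj].
by rewrite /= nth_rcons size_compl_kernels kj IH.
Qed.

Lemma compl_kernel0 {R : realType} (A : nat -> nat -> R) (n : nat) :
  compl_kernel A n 0 = 1 / A n 0%N.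
Proof. by []. Qed.

Lemma compl_kernel_rec {R : realType} (A : nat -> nat -> R) (n j : nat) :
  (1 <= j)%N ->
  compl_kernel A n j = 1 / A (n - j)%N 0%N *
    \sum_(0 <= k < j) (A (n - k)%N (j - k - 1)%N - A (n - k)%N (j - k)%N)
                      * compl_kernel A n k.
Proof.
case: j => // j _; rewrite {1}/compl_kernel /= nth_rcons size_compl_kernels.
rewrite ltnn eqxx; congr (_ * _); apply: eq_big_nat => k /andP[_ kj].
by rewrite nth_compl_kernels.
Qed.

(* Main.v *)
From HB Require Import structures.
Require Import Defs.
From mathcomp Require Import all_boot all_order all_algebra.
From mathcomp Require Import all_classical all_reals all_analysis.
From mathcomp Require Import measurable_realfun ring lra zify.

Import Order.TTheory GRing.Theory Num.Theory.
Import numFieldNormedType.Exports.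

Local Open Scope classical_set_scope.
Local Open Scope ring_scope.

(** The theorem is a discrete Gronwall inequality, proved by strong induction on
    [n].  Write [mu = 2 * max 1 rho * piA * Lambda], let [E n] be the
    Mittag-Leffler value at [mu * t n ^ alpha], and let [G n] be the factor
    [v 0 + max_k sum_j P g] of the conclusion.

    If [v n] does not exceed some earlier [v k], the bound for [v k] suffices,
    because [E] and [G] are nondecreasing.  Otherwise every [offset theta v k]
    with [k <= n] is at most [v n], so each energy inequality is linear in [v n]
    on the right; summing them against the complementary kernels inverts the
    operator given by [A] ([compl_kernel_inverse]), and dividing by [v n] leaves
    [v n <= G n + sum_j P_(n-j) sum_k lambda_(j-k) v^(k-theta)].  The step size
    restriction makes the term [j = n] at most [v n / 2] ([compl_kernel0_le],
    [max_step_small]), while in the terms [j < n] the induction hypothesis gives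
    at most [P_(n-j) * Lambda * 2 * E j * G n].  What remains is
    [sum_(j < n) P_(n-j) * 2 * Lambda * E j <= E n - 1]
    ([compl_kernel_sum_ml]): the discrete counterpart of the fact that
    [E_alpha (mu t^alpha)] solves a fractional differential equation.

    This is checked on each term of the Mittag-Leffler series
    ([compl_kernel_sum_pomega]).  From the semigroup law
    [omega_(1-alpha) * omega_b = omega_(1-alpha+b)] (convolution), the value of
    the right-hand side at [t j] is a sum of integrals over the mesh cells of
    [omega_(1-alpha) (t j - s) omega_b s].  On a cell, Chebyshev's inequality if
    [omega_b] is decreasing, or the crude bound of [omega_b] by its value at the
    right end if it is increasing (the ratio [rho] then pays for moving to the
    next cell), bounds this integral by the kernel [A] times an increment of
    [omega_(1+b)]; the complementary kernels sum the increments up.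

    The semigroup law itself is Euler's Beta integral: Tonelli's theorem and
    affine changes of variables turn [Gamma a * Gamma b] into [Gamma (a + b)]
    times the Beta integral.  *)

(** * Affine change of variables *)

(** Lebesgue measure is [c] times its image under [x |-> c * x + d], since the
    two measures agree on half-open intervals.  *)
Lemma ge0_integral_affine {R : realType} (c d : R) (f : R -> \bar R) :
  0 < c -> measurable_fun setT f -> (forall x, (0 <= f x)%E) ->
  (\int[@lebesgue_measure R]_x f x
   = c%:E * \int[@lebesgue_measure R]_x f (c * x + d)%R)%E.
Proof.
move=> c0 mf f0.
pose phi (x : R) : measurableTypeR R := c * x + d.
have mphi : measurable_fun setT phi.
  by apply: measurable_funD => //; exact: measurable_funM.
pose image : {measure set (measurableTypeR R) -> \bar R} :=
  pushforward (@lebesgue_measure R) phi.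
pose nu := image mphi.
have muE A : measurable A ->
    lebesgue_measure A = mscale (NngNum (ltW c0)) nu A.
  apply: lebesgue_measure_unique => _ [[a b]] _ <-.
  pose I : set R := `](a - d) / c, (b - d) / c]%classic.
  rewrite [RHS](_ : _ = (c%:E * lebesgue_measure I)%E); last first.
    rewrite /mscale/= /nu /= /pushforward /=; congr (_ * lebesgue_measure _)%E.
    apply/seteqP; split=> x /=; rewrite /I /phi /= !in_itv/= => /andP[h1 h2].
      rewrite ltr_pdivrMr// ler_pdivlMr// mulrC; apply/andP; split; lra.
    move: h1 h2; rewrite ltr_pdivrMr// ler_pdivlMr// mulrC => h1 h2.
    apply/andP; split; lra.
  rewrite /I !lebesgue_measure_itv/= !lte_fin.
  rewrite ltr_pM2r ?invr_gt0// ltrD2r; case: ifP => _; last by rewrite mule0.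
  by rewrite -!EFinD -EFinM; congr EFin; field; rewrite gt_eqF.
rewrite (@eq_measure_integral _ _ _ _ (mscale (NngNum (ltW c0)) nu)).
- rewrite ge0_integral_mscale//= ge0_integral_pushforward//=.
- by move=> A mA _; exact: muE.
Qed.

(** * The Beta integral *)

Lemma integral_gt0 {R : realType} (a b : R) (f : R -> R) :
  a < b -> measurable_fun setT f -> (forall x, 0 <= f x) ->
  (forall x, a < x < b -> 0 < f x) ->
  (0 < \int[@lebesgue_measure R]_x (f x)%:E)%E.
Proof.
move=> ab mf f0 fgt0; rewrite lt0e integral_ge0 ?andbT; last first.
  by move=> x _; rewrite lee_fin.
apply/eqP => I0.
have mfE : measurable_fun setT (EFin \o f) by exact/measurable_EFinP.
have /(ae_eq_integral_abs lebesgue_measure measurableT mfE) [N [mN N0 subN]] :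
    (\int[@lebesgue_measure R]_x `|(EFin \o f) x| = 0)%E.
  by rewrite -[RHS]I0; apply: eq_integral => x _ /=; rewrite ger0_norm.
have : (lebesgue_measure (`]a, b[%classic : set R) <= lebesgue_measure N)%E.
  apply: le_measure; rewrite ?inE//.
  move=> x /=; rewrite in_itv/= => /fgt0 fx; apply: subN => /=.
  by move=> /(_ Logic.I) [] /eqP; rewrite gt_eqF.
by rewrite N0 lebesgue_measure_itv/= lte_fin ab -EFinD lee_fin leNgt subr_gt0 ab.
Qed.

(** Truncating the power at 0 lets convolutions and Euler integrals be taken
    over the whole line, where changes of variables and Tonelli's theorem
    need no adjustment of domains.  *)
Definition ppow {R : realType} (a : R) : R -> R :=
  (fun x => x `^ (a - 1)) \_ `]0, +oo[.

Lemma ppow_pos {R : realType} (a x : R) : 0 < x -> ppow a x = x `^ (a - 1).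
Proof. by move=> x0; rewrite /ppow patchE ifT// inE/= in_itv/= x0. Qed.

Lemma ppow_npos {R : realType} (a x : R) : x <= 0 -> ppow a x = 0.
Proof.
move=> x0; rewrite /ppow patchE ifF//; apply/negP.
by rewrite inE/= in_itv/= andbT ltNge x0.
Qed.

Lemma ppow_ge0 {R : realType} (a x : R) : 0 <= ppow a x.
Proof.
case: (ltP 0 x) => x0; last by rewrite ppow_npos.
by rewrite ppow_pos// powR_ge0.
Qed.

Lemma measurable_ppow {R : realType} (a : R) : measurable_fun setT (ppow a).
Proof.
apply/(measurable_restrictT (fun x => x `^ (a - 1))) => //.
apply: measurable_funTS.
by apply: (measurable_powR (R := R)).
Qed.

Lemma ppow_scale {R : realType} (a t x : R) : 0 < t ->
  ppow a (t * x) = t `^ (a - 1) * ppow a x.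
Proof.
move=> t0; case: (ltP 0 x) => x0.
  by rewrite !ppow_pos ?mulr_gt0// powRM// ltW.
by rewrite !ppow_npos ?mulr0// pmulr_rle0.
Qed.

(** At [t = 1] this is the Beta integral.  *)
Definition pconv {R : realType} (a b t : R) : \bar R :=
  (\int[@lebesgue_measure R]_s (ppow a (t - s) * ppow b s)%:E)%E.

(** The Gamma integral with values in the extended reals, so that it can be
    computed with before it is known to be finite.  *)
Definition euler_integral {R : realType} (a : R) : \bar R :=
  (\int[@lebesgue_measure R]_x (ppow a x * expR (- x))%:E)%E.

Lemma measurable_pconv_integrand {R : realType} (a b t : R) :
  measurable_fun setT (fun s : R => ppow a (t - s) * ppow b s).
Proof.
apply: measurable_funM; last exact: measurable_ppow.
apply: measurableT_comp; first exact: measurable_ppow.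
exact: measurable_funB.
Qed.

Lemma measurable_pconv_integrandE {R : realType} (a b t : R) :
  measurable_fun setT (fun s : R => (ppow a (t - s) * ppow b s)%:E).
Proof. by apply/measurable_EFinP; exact: measurable_pconv_integrand. Qed.

(** Substituting [s = t * r] takes the powers of [t] out.  *)
Lemma pconv_scale {R : realType} (a b t : R) :
  (pconv a b t = (ppow (a + b) t)%:E * pconv a b 1)%E.
Proof.
case: (ltP 0 t) => t0; last first.
  rewrite ppow_npos// mul0e /pconv integral0_eq// => s _.
  case: (ltP 0 s) => s0; last by rewrite (ppow_npos _ s)// mulr0.
  by rewrite ppow_npos ?mul0r//; lra.
have C0 s : (0 <= (ppow a (t - s) * ppow b s)%:E)%E.
  by rewrite lee_fin mulr_ge0 ?ppow_ge0.
rewrite {1}/pconv (ge0_integral_affine t 0 _ t0 (measurable_pconv_integrandE a b t) C0).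
under eq_integral => s _.
  rewrite addr0 -{1}(mulr1 t) -mulrBr !ppow_scale// mulrACA EFinM.
  over.
rewrite ge0_integralZl//=; last 3 first.
- by apply/measurable_EFinP; exact: measurable_pconv_integrand.
- by move=> s _; rewrite lee_fin mulr_ge0 ?ppow_ge0.
- by rewrite lee_fin mulr_ge0 ?powR_ge0.
rewrite muleA -EFinM; congr (_%:E * _)%E.
have tN0 : t != 0 by rewrite gt_eqF.
rewrite ppow_pos// -[X in X * _ = _](powRr1 (ltW t0)) -!powRD ?tN0 ?implybT//.
by congr (_ `^ _); ring.
Qed.

Lemma measurable_expN {R : realType} : measurable_fun setT (fun x : R => expR (- x)).
Proof. by apply: measurableT_comp => //; exact: measurable_funN. Qed.

(** Substituting [u = w - s] in the inner integral of the product turns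
    [exp (- s) * exp (- u)] into [exp (- w)]; after exchanging the integrals the
    inner one is the convolution at [w], which scales like [w ^ (a + b - 1)].  *)
Lemma euler_integral_mul {R : realType} (a b : R) :
  (euler_integral b * euler_integral a = euler_integral (a + b) * pconv a b 1)%E.
Proof.
have mE c : measurable_fun setT (fun x : R => ppow c x * expR (- x)).
  by apply: measurable_funM; [exact: measurable_ppow|exact: measurable_expN].
have mEE c : measurable_fun setT (fun x : R => (ppow c x * expR (- x))%:E).
  by apply/measurable_EFinP; exact: mE.
have E0 c (x : R) : (0 <= (ppow c x * expR (- x))%:E)%E.
  by rewrite lee_fin mulr_ge0 ?ppow_ge0// expR_ge0.
have C0 : (0 <= pconv a b 1)%E.
  by apply: integral_ge0 => x _; rewrite lee_fin mulr_ge0 ?ppow_ge0.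
pose F (z : measurableTypeR R * measurableTypeR R) : \bar R :=
  (ppow a (z.2 - z.1) * ppow b z.1 * expR (- z.2))%:E.
have mF : measurable_fun setT F.
  apply/measurable_EFinP; do 2?[apply: measurable_funM].
  - apply: (measurableT_comp (measurable_ppow a)).
    by apply: measurable_funB; [exact: measurable_snd|exact: measurable_fst].
  - exact: (measurableT_comp (measurable_ppow b) measurable_fst).
  - exact: (measurableT_comp measurable_expN measurable_snd).
have F0 z : (0 <= F z)%E.
  by rewrite lee_fin !mulr_ge0 ?ppow_ge0 ?expR_ge0.
transitivity (\int[@lebesgue_measure R]_s \int[@lebesgue_measure R]_w F (s, w))%E.
  rewrite {1}/euler_integral -ge0_integralZr//; last 2 first.
  - exact: mEE.
  - by apply: integral_ge0 => x _.
  apply: eq_integral => s _.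
  rewrite /euler_integral (ge0_integral_affine 1 (- s))//.
  rewrite mul1e -ge0_integralZl//; last first.
    apply: (measurableT_comp (mEE a) (g := fun x : R => 1 * x - s)).
    by apply: measurable_funB => //; exact: measurable_funM.
  apply: eq_integral => w _; rewrite /F/= -EFinM; congr EFin.
  rewrite mul1r opprB expRD; have : expR s != 0 by rewrite gt_eqF ?expR_gt0.
  by rewrite (expRN s) => ?; field.
rewrite (fubini_tonelli F)// /euler_integral -ge0_integralZr//; last exact: mEE.
apply: eq_integral => w _.
rewrite /F/= (_ : (fun s => _) = (fun s : R =>
    (expR (- w))%:E * (ppow a (w - s) * ppow b s)%:E)%E); last first.
  by apply/funext => s; rewrite -EFinM mulrC.
rewrite ge0_integralZl; last 4 first.
- exact: measurableT.
- exact: measurable_pconv_integrandE.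
- by move=> s _; rewrite lee_fin mulr_ge0 ?ppow_ge0.
- by rewrite lee_fin expR_ge0.
by rewrite -/(pconv a b w) pconv_scale EFinM muleCA muleA.
Qed.

(** * The Gamma function *)

Lemma euler_integral_ge0 {R : realType} (a : R) : (0 <= euler_integral a)%E.
Proof.
by apply: integral_ge0 => x _; rewrite lee_fin mulr_ge0 ?ppow_ge0 ?expR_ge0.
Qed.

Lemma measurable_euler_integrand {R : realType} (a : R) :
  measurable_fun setT (fun x : R => ppow a x * expR (- x)).
Proof.
by apply: measurable_funM; [exact: measurable_ppow|exact: measurable_expN].
Qed.

Lemma measurable_euler_integrandE {R : realType} (a : R) :
  measurable_fun setT (fun x : R => (ppow a x * expR (- x))%:E).
Proof. by apply/measurable_EFinP; exact: measurable_euler_integrand. Qed.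

Lemma euler_integral_gt0 {R : realType} (a : R) : (0 < euler_integral a)%E.
Proof.
apply: (integral_gt0 0 1) => //.
- exact: measurable_euler_integrand.
- by move=> x; rewrite mulr_ge0 ?ppow_ge0 ?expR_ge0.
- by move=> x /andP[x0 _]; rewrite mulr_gt0 ?expR_gt0// ppow_pos// powR_gt0.
Qed.

Lemma pconv_gt0 {R : realType} (a b : R) : (0 < pconv a b 1)%E.
Proof.
apply: (integral_gt0 0 1) => //.
- exact: measurable_pconv_integrand.
- by move=> x; rewrite mulr_ge0 ?ppow_ge0.
- by move=> x /andP[x0 x1]; rewrite mulr_gt0// ppow_pos ?powR_gt0// subr_gt0.
Qed.

Lemma euler_integral1 {R : realType} : euler_integral (1 : R) = 1%E.
Proof.
rewrite -(@integral_exponential_pdf R 1)//.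
pose f (x : R) := (expR (- x))%:E.
have pdfE x : (exponential_pdf (1 : R) x)%:E = (f \_ `[0, +oo[) x.
  by rewrite /exponential_pdf !patchE; case: ifP => // _; rewrite mul1r mulN1r.
have ppE x : (ppow (1 : R) x * expR (- x))%:E = (f \_ `]0, +oo[) x.
  by rewrite /ppow !patchE; case: ifP => _; rewrite ?mul0r// subrr powRr0 mul1r.
rewrite /euler_integral; under eq_integral do rewrite ppE.
under [RHS]eq_integral do rewrite pdfE.
rewrite -!integral_mkcond integral_itv_obnd_cbnd//.
by apply: measurable_funTS; apply/measurable_EFinP; exact: measurable_expN.
Qed.

(** The integral of [x ^ (a - 1)] over ]0, 1] is the limit of its values
    [(1 - e ^ a) / a] over [e, 1] with [e = 1 / n.+1].  *)
Lemma pconv1_lty {R : realType} (a : R) : 0 < a -> (pconv 1 a (1 : R) < +oo)%E.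
Proof.
move=> a0; pose f (x : R) := x `^ (a - 1); pose F (x : R) := a^-1 * x `^ a.
have mf (D : set R) : measurable_fun D (fun x : R => (f x)%:E).
  by apply: measurable_funTS; apply/measurable_EFinP; exact: (measurable_powR (R := R)).
pose I (n : nat) := `[n.+1%:R^-1, 1 : R]%classic.
(* For [n = 0] the interval is a point, outside the scope of the
   fundamental theorem of calculus used for [n > 0]. *)
have If n : (\int[@lebesgue_measure R]_(x in I n) (f x)%:E <= (a^-1)%:E)%E.
  have [n0|n0] := eqVneq n 0%N.
    rewrite /I n0 invr1 set_itv1 integral_set1 lee_fin invr_ge0 ltW//.
  have e0 : 0 < n.+1%:R^-1 :> R by rewrite invr_gt0.
  have e1 : n.+1%:R^-1 < 1 :> R by rewrite invf_lt1// ltr1n ltnS lt0n.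
  have dpow b (x : R) : 0 < x -> derivable (@powR R ^~ b) x 1.
    by move=> x0; apply: derivable_powR; rewrite in_itv/= x0.
  have dF (x : R) : 0 < x -> derivable F x 1.
    by move=> x0; apply: derivableM => //; exact: dpow.
  have cF (x : R) : 0 < x -> {for x, continuous F}.
    by move=> /dF /derivable1_diffP /differentiable_continuous.
  rewrite /I (continuous_FTC2 (F := F) e1).
  - rewrite /F powR1 mulr1 -EFinB lee_fin gerBl mulr_ge0 ?powR_ge0//.
    by rewrite invr_ge0 ltW.
  - apply: derivable_within_continuous => x; rewrite in_itv/= => /andP[x0 _].
    exact/dpow/(lt_le_trans e0).
  - split.
    + move=> x; rewrite in_itv/= => /andP[x0 _]; exact/dF/(lt_trans e0).
    + exact/cvg_at_right_filter/cF.
    + exact/cvg_at_left_filter/cF.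
  - move=> x; rewrite in_itv/= => /andP[/(lt_trans e0) x0 _].
    rewrite derive1Ml; last exact: dpow.
    by rewrite powR_derive1 ?in_itv/= ?x0// mulrA mulVf ?mul1r// gt_eqF.
have UI : \bigcup_n I n = `]0, 1 : R]%classic.
  apply/seteqP; split=> x /=.
    move=> [n _]; rewrite /I /= !in_itv/= => /andP[nx ->]; rewrite andbT.
    by apply: lt_le_trans nx; rewrite invr_gt0.
  rewrite in_itv/= => /andP[x0 x1]; exists (Num.truncn x^-1) => //=.
  rewrite /I /= in_itv/= x1 andbT invf_ple ?posrE//.
  by rewrite ltW// truncnS_gt.
have le1 : (\int[@lebesgue_measure R]_(x in `]0%R, 1%R]) (f x)%:E <= (a^-1)%:E)%E.
  rewrite -UI.
  have cvI : (\int[@lebesgue_measure R]_(x in I n) (f x)%:E)%E @[n --> \oo] -->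
             (\int[@lebesgue_measure R]_(x in \bigcup_n I n) (f x)%:E)%E.
    apply: ge0_nondecreasing_set_cvg_integral => //.
    - move=> n m nm; apply/subsetPset => x; rewrite /I /= !in_itv/= => /andP[nx ->].
      rewrite andbT (le_trans _ nx)// lef_pV2 ?posrE//.
      by rewrite ler_nat.
    - by move=> n; exact: measurable_itv.
    - by move=> n; exact: mf.
    - by move=> n x _; rewrite lee_fin powR_ge0.
  by apply: (cvge_to_le cvI); apply: nearW => n; exact: If.
apply: le_lt_trans (ltry a^-1); apply: le_trans le1.
rewrite integral_mkcond; apply: ge0_le_integral => //.
- by move=> x _; rewrite lee_fin mulr_ge0 ?ppow_ge0.
- exact: measurable_pconv_integrandE.
- by apply/(measurable_restrictT (fun x : R => (f x)%:E)) => //.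
- move=> x _; rewrite patchE; case: (ltP 0 x) => x0; last first.
    by rewrite (ppow_npos _ x)// mulr0; case: ifP => // _; rewrite lee_fin powR_ge0.
  case: (ltP x 1) => x1; last first.
    rewrite (ppow_npos _ (1 - x)) ?subr_le0// mul0r.
    by case: ifP => // _; rewrite lee_fin powR_ge0.
  rewrite ifT; last by rewrite inE/= in_itv/= x0 ltW.
  by rewrite !ppow_pos ?subr_gt0// subrr powRr0 mul1r.
Qed.

(** Below 1 the integrand is at most [x ^ (b - 1)], and above 1 it is at most
    [exp (- x)] because [b <= 1].  *)
Lemma euler_integral_lty_le1 {R : realType} (b : R) :
  0 < b -> b <= 1 -> (euler_integral b < +oo)%E.
Proof.
move=> b0 b1.
apply: (@le_lt_trans _ _ (pconv 1 b (1 : R) + euler_integral (1 : R))%E); last first.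
  apply: lte_add_pinfty; first exact: pconv1_lty.
  by rewrite euler_integral1 ltry.
rewrite -ge0_integralD//; last 4 first.
- by move=> x _; rewrite lee_fin mulr_ge0 ?ppow_ge0.
- exact: measurable_pconv_integrandE.
- by move=> x _; rewrite lee_fin mulr_ge0 ?ppow_ge0 ?expR_ge0.
- exact: measurable_euler_integrandE.
apply: ge0_le_integral => //.
- by move=> x _; rewrite lee_fin mulr_ge0 ?ppow_ge0 ?expR_ge0.
- exact: measurable_euler_integrandE.
- by apply: emeasurable_funD;
    [exact: measurable_pconv_integrandE|exact: measurable_euler_integrandE].
move=> x _; rewrite -EFinD lee_fin; case: (ltP 0 x) => x0; last first.
  by rewrite !(ppow_npos _ x)// !mul0r mulr0 addr0.
rewrite (ppow_pos _ x x0) (ppow_pos 1 x x0) subrr powRr0 mul1r.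
case: (ltP x 1) => x1.
  rewrite ppow_pos ?subr_gt0// subrr powRr0 mul1r ler_wpDr ?expR_ge0//.
  by rewrite ler_piMr ?powR_ge0// -expR0 ler_expR oppr_le0 ltW.
rewrite ppow_npos ?subr_le0// mul0r add0r ler_piMl ?expR_ge0//.
rewrite (le_trans (ler_powR x1 (_ : b - 1 <= 0))) ?powRr0//.
by rewrite subr_le0.
Qed.

(** In the product formula the Beta factor is positive, so it cannot turn an
    infinite value into a finite product.  *)
Lemma euler_integral_add_lty {R : realType} (a b : R) :
  (euler_integral a < +oo -> euler_integral b < +oo ->
   euler_integral (a + b) < +oo)%E.
Proof.
move=> Ia Ib.
have : (euler_integral (a + b) * pconv a b 1 < +oo)%E.
  rewrite -euler_integral_mul; apply: lte_mul_pinfty.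
  - exact: euler_integral_ge0.
  - by rewrite (ge0_fin_numE (euler_integral_ge0 b)).
  - exact: Ia.
rewrite !ltey; apply: contra => /eqP ->.
by rewrite gt0_mulye// pconv_gt0.
Qed.

(** Every positive [a] is a multiple of some [b <= 1], so finiteness propagates
    by the additive step.  *)
Lemma euler_integral_lty {R : realType} (a : R) :
  0 < a -> (euler_integral a < +oo)%E.
Proof.
move=> a0; pose n := Num.truncn a; pose b := a / n.+1%:R.
have Ib : (euler_integral b < +oo)%E.
  apply: euler_integral_lty_le1; first by rewrite divr_gt0.
  by rewrite ler_pdivrMr// mul1r ltW// truncnS_gt.
have -> : a = b *+ n.+1 by rewrite -[RHS]mulr_natr mulfVK.
elim: {+}n => [|m IH]; first by rewrite mulr1n.
by rewrite mulrS euler_integral_add_lty.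
Qed.

Lemma euler_integralE {R : realType} (a : R) :
  0 < a -> euler_integral a = (Gamma a)%:E.
Proof.
move=> a0; rewrite -(fineK (_ : euler_integral a \is a fin_num)); last first.
  by rewrite ge0_fin_numE ?euler_integral_ge0// euler_integral_lty.
congr (fine _)%:E; rewrite /Gamma [RHS]integral_mkcond; apply: eq_integral => x _.
by rewrite /ppow !patchE; case: ifP => _ //; rewrite mul0r.
Qed.

Lemma Gamma_gt0 {R : realType} (a : R) : 0 < a -> 0 < Gamma a.
Proof. by move=> a0; rewrite -lte_fin -euler_integralE// euler_integral_gt0. Qed.

Lemma Gamma1 {R : realType} : Gamma (1 : R) = 1.
Proof. by apply: EFin_inj; rewrite -euler_integralE// euler_integral1. Qed.

(** Only the part of the integral beyond [M] is kept, where the power is at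
    least [M ^ x].  Since [M] is arbitrary, this makes [Gamma] grow faster than
    every exponential, which is what the Mittag-Leffler series needs.  *)
Lemma Gamma_ge {R : realType} (x M : R) : 0 <= x -> 0 < M ->
  M `^ x * expR (- M) <= Gamma (1 + x).
Proof.
move=> x0 M0; rewrite -lee_fin -euler_integralE ?ltr_wpDr//.
rewrite /euler_integral (ge0_integral_affine 1 M)//; last 2 first.
- exact: measurable_euler_integrandE.
- by move=> r; rewrite lee_fin mulr_ge0 ?ppow_ge0 ?expR_ge0.
rewrite mul1e -[leLHS]mule1 -euler_integral1 -ge0_integralZl//; last 3 first.
- exact: measurable_euler_integrandE.
- by move=> r _; rewrite lee_fin mulr_ge0 ?ppow_ge0 ?expR_ge0.
- by rewrite lee_fin mulr_ge0 ?powR_ge0 ?expR_ge0.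
apply: ge0_le_integral => //.
- by move=> r _; rewrite lee_fin !mulr_ge0 ?ppow_ge0 ?powR_ge0 ?expR_ge0.
- by apply: emeasurable_funM => //; exact: measurable_euler_integrandE.
- apply: (measurableT_comp (measurable_euler_integrandE (1 + x)) (g := fun r : R => 1 * r + M)).
  by apply: measurable_funD => //; exact: measurable_funM.
move=> r _; rewrite -EFinM lee_fin mul1r.
case: (ltP 0 r) => r0; last first.
  by rewrite (ppow_npos _ r)// mul0r mulr0 mulr_ge0 ?ppow_ge0 ?expR_ge0.
rewrite (ppow_pos 1 r r0) subrr powRr0 mul1r -mulrA -expRD opprD [- r - M]addrC.
rewrite ler_wpM2r ?expR_ge0// ppow_pos ?addr_gt0// addrAC subrr add0r.
by rewrite ge0_ler_powR// ?nnegrE ?addr_ge0 ?lerDr// ltW.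
Qed.

(** [omega] on ]0, +oo[, truncated like the power.  *)
Definition pomega {R : realType} (a x : R) : R := ppow a x / Gamma a.

(** The semigroup law of fractional integration, from the value
    [Gamma a * Gamma b / Gamma (a + b)] of the Beta integral.  *)
Lemma pomega_conv {R : realType} (a b t : R) : 0 < a -> 0 < b ->
  (\int[@lebesgue_measure R]_s (pomega a (t - s) * pomega b s)%:E)%E
  = (pomega (a + b) t)%:E.
Proof.
move=> a0 b0.
have Ga := Gamma_gt0 _ a0; have Gb := Gamma_gt0 _ b0.
have Gab := Gamma_gt0 _ (addr_gt0 a0 b0).
have C1 : pconv a b 1 = (Gamma a * Gamma b / Gamma (a + b))%:E.
  have := euler_integral_mul a b; rewrite !euler_integralE ?addr_gt0// => E.
  have Cfin : pconv a b 1 \is a fin_num.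
    rewrite (ge0_fin_numE (ltW (pconv_gt0 a b))) ltey; apply/eqP => C.
    by move: E; rewrite C gt0_muley ?lte_fin.
  move: E; rewrite -(fineK Cfin) -!EFinM => -[E]; apply: (congr1 EFin).
  move: (fine _) E => c; move: Ga Gb Gab; clear.
  move: (Gamma a) (Gamma b) (Gamma (a + b)) => ga gb gab ga0 gb0 gab0 E.
  by rewrite [ga * _]mulrC E mulrAC divff ?mul1r// gt_eqF.
under eq_integral => s _.
  rewrite /pomega mulrACA mulrC EFinM; over.
rewrite ge0_integralZl//; last 3 first.
- exact: measurable_pconv_integrandE.
- by move=> s _; rewrite lee_fin mulr_ge0 ?ppow_ge0.
- by rewrite lee_fin; apply: mulr_ge0; rewrite invr_ge0; apply: ltW.
rewrite -/(pconv a b t) pconv_scale C1 -!EFinM; apply: (congr1 EFin).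
rewrite /pomega; move: Ga Gb Gab; clear.
move: (Gamma a) (Gamma b) (Gamma (a + b)) => ga gb gab ga0 gb0 gab0.
by field; rewrite !gt_eqF.
Qed.

(** * Integrals over a mesh cell *)

(** Cells are open because [omega_(1-alpha) (t - s)] is nondecreasing in [s]
    only up to its singularity [s = t], where it takes the value 0.  *)
Definition cell_int {R : realType} (x y : R) (h : R -> R) : R :=
  \int[@lebesgue_measure R]_(s in `]x, y[) h s.

Definition cell_integrable {R : realType} (x y : R) (h : R -> R) :=
  (@lebesgue_measure R).-integrable `]x, y[ (EFin \o h).

Lemma cell_integrableD {R : realType} (x y : R) (f g : R -> R) :
  cell_integrable x y f -> cell_integrable x y g ->
  cell_integrable x y (fun s => f s + g s).
Proof. by move=> If Ig; exact: (integrableD _ If Ig). Qed.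

Lemma cell_integrableZ {R : realType} (x y k : R) (f : R -> R) :
  cell_integrable x y f -> cell_integrable x y (fun s => k * f s).
Proof. by move=> If; exact: (integrableZl _ k If). Qed.

Lemma cell_integrable_cst {R : realType} (x y k : R) :
  cell_integrable x y (fun=> k).
Proof.
apply/integrableP; split.
  by apply/measurable_EFinP; exact: measurable_cst.
rewrite /= integral_cst//= lebesgue_measure_itv/=.
by case: ifP => _; rewrite ?mule0 ?ltry// -EFinD -EFinM ltry.
Qed.

Lemma cell_intD {R : realType} (x y : R) (f g : R -> R) :
  cell_integrable x y f -> cell_integrable x y g ->
  cell_int x y (fun s => f s + g s) = cell_int x y f + cell_int x y g.
Proof. by move=> If Ig; exact: (RintegralD _ If Ig). Qed.

Lemma cell_intZ {R : realType} (x y k : R) (f : R -> R) :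
  cell_integrable x y f ->
  cell_int x y (fun s => k * f s) = k * cell_int x y f.
Proof. by move=> If; exact: RintegralZl. Qed.

Lemma cell_int_cst {R : realType} (x y k : R) : x <= y ->
  cell_int x y (fun=> k) = k * (y - x).
Proof.
move=> xy; rewrite /cell_int Rintegral_cst//=.
rewrite lebesgue_measure_itv/= lte_fin; case: ltP => [_|yx] //=.
by rewrite (_ : y = x) ?subrr//; apply/eqP; rewrite eq_le xy yx.
Qed.

Lemma le_cell_int {R : realType} (x y : R) (f g : R -> R) :
  cell_integrable x y f -> cell_integrable x y g ->
  (forall s, x < s < y -> f s <= g s) -> cell_int x y f <= cell_int x y g.
Proof.
move=> If Ig fg; exact: le_Rintegral.
Qed.

Lemma eq_cell_int {R : realType} (x y : R) (f g : R -> R) :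
  (forall s, x < s < y -> f s = g s) -> cell_int x y f = cell_int x y g.
Proof.
by move=> fg; apply: eq_Rintegral => s; rewrite inE/= in_itv/=; exact: fg.
Qed.

Lemma eq_cell_integrable {R : realType} (x y : R) (f g : R -> R) :
  (forall s, x < s < y -> f s = g s) ->
  cell_integrable x y f -> cell_integrable x y g.
Proof.
move=> fg; apply: eq_integrable => // s.
by rewrite inE/= in_itv/= => /fg ->.
Qed.

Lemma sub_cell_integrable {R : realType} (x y x' y' : R) (f : R -> R) :
  x <= x' -> y' <= y -> cell_integrable x y f -> cell_integrable x' y' f.
Proof.
move=> xx yy; apply: integrableS => // s /=;
  rewrite !in_itv/= => /andP[s1 s2].
by rewrite (le_lt_trans xx s1) (lt_le_trans s2 yy).
Qed.

Lemma cell_int_split {R : realType} (x y z : R) (f : R -> R) :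
  x <= y -> y <= z -> cell_integrable x z f ->
  cell_int x z f = cell_int x y f + cell_int y z f.
Proof.
move=> xy; rewrite le_eqVlt => /predU1P[<- _|yz If].
  by rewrite [cell_int y y _](_ : _ = 0) ?addr0// /cell_int set_itvoo0 ?Rintegral_set0.
have If' : cell_integrable x y f by apply: sub_cell_integrable If; rewrite // ltW.
rewrite /cell_int (Rintegral_itv_bndo_bndc If').
rewrite -(@Rintegral_itvB _ f (BRight x) (BLeft z) y) ?bnd_simp//.
by rewrite addrC subrK.
Qed.

(** Integrate [(f u - f s) * (g u - g s) <= 0] in [u] for fixed [s], and then
    in [s]: since the integrand is a sum of products, no theorem on double
    integrals is needed.  *)
Lemma chebyshev_cell {R : realType} (x y : R) (f g : R -> R) :
  x <= y ->
  {in `]x, y[ &, {homo f : s u / s <= u}} ->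
  {in `]x, y[ &, {homo g : s u / s <= u >-> u <= s}} ->
  cell_integrable x y f -> cell_integrable x y g ->
  cell_integrable x y (fun s => f s * g s) ->
  (y - x) * cell_int x y (fun s => f s * g s) <= cell_int x y f * cell_int x y g.
Proof.
move=> xy f_nd g_ni If Ig Ifg.
set F := cell_int x y f; set G := cell_int x y g.
set H := cell_int x y (fun s => f s * g s).
have rearr s u : s \in `]x, y[ -> u \in `]x, y[ ->
    f u * g u + f s * g s <= g s * f u + f s * g u.
  move=> sI uI; rewrite -subr_ge0.
  rewrite (_ : _ - _ = (f s - f u) * (g u - g s)); last by ring.
  case: (leP s u) => su.
    by rewrite mulr_le0// subr_le0; [exact: f_nd|exact: g_ni].
  by rewrite mulr_ge0// subr_ge0; [apply: f_nd|apply: g_ni]; rewrite // ltW.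
have inner s : s \in `]x, y[ -> H + (y - x) * (f s * g s) <= F * g s + G * f s.
  move=> sI; rewrite [_ * (f s * g s)]mulrC -cell_int_cst// -cell_intD//; last first.
    exact: cell_integrable_cst.
  rewrite [F * _]mulrC [G * _]mulrC -!cell_intZ// -cell_intD; last 2 first.
  - exact: cell_integrableZ.
  - exact: cell_integrableZ.
  apply: le_cell_int.
  - by apply: cell_integrableD => //; exact: cell_integrable_cst.
  - by apply: cell_integrableD; exact: cell_integrableZ.
  - by move=> u uI; apply: rearr; rewrite // in_itv.
have : cell_int x y (fun s => H + (y - x) * (f s * g s)) <=
       cell_int x y (fun s => F * g s + G * f s).
  apply: le_cell_int.
  - by apply: cell_integrableD; [exact: cell_integrable_cst|exact: cell_integrableZ].
  - by apply: cell_integrableD; exact: cell_integrableZ.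
  - by move=> s sI; apply: inner; rewrite in_itv.
rewrite !cell_intD ?cell_intZ ?cell_int_cst//; try exact: cell_integrableZ;
  try exact: cell_integrable_cst.
by rewrite -/F -/G -/H; nra.
Qed.

(** * The convolution semigroup on mesh cells *)

Lemma pomegaE {R : realType} (a x : R) : 0 < x -> pomega a x = omega a x.
Proof. by move=> x0; rewrite /pomega /omega ppow_pos. Qed.

Lemma pomega_npos {R : realType} (a x : R) : x <= 0 -> pomega a x = 0.
Proof. by move=> x0; rewrite /pomega ppow_npos// mul0r. Qed.

Lemma pomega_ge0 {R : realType} (a x : R) : 0 < a -> 0 <= pomega a x.
Proof. by move=> a0; rewrite mulr_ge0 ?ppow_ge0// invr_ge0 ltW ?Gamma_gt0. Qed.

Lemma pomega1 {R : realType} (x : R) : 0 < x -> pomega 1 x = 1.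
Proof. by move=> x0; rewrite /pomega ppow_pos// Gamma1 subrr powRr0 divr1. Qed.

Lemma measurable_pomega {R : realType} (a : R) : measurable_fun setT (pomega a).
Proof. by apply: measurable_funM => //; exact: measurable_ppow. Qed.

Lemma measurable_pomega_conv {R : realType} (a b t : R) :
  measurable_fun setT (fun s : R => (pomega a (t - s) * pomega b s)%:E).
Proof.
apply/measurable_EFinP; apply: measurable_funM; last exact: measurable_pomega.
apply: (measurableT_comp (measurable_pomega a) (g := fun s : R => t - s)).
exact: measurable_funB.
Qed.

Lemma cell_int_fine {R : realType} (x y : R) (h : R -> R) :
  (forall s, ~~ (x < s < y) -> h s = 0) ->
  cell_int x y h = fine (\int[@lebesgue_measure R]_s (h s)%:E)%E.
Proof.
move=> h0; rewrite /cell_int /Rintegral integral_mkcond; congr fine.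
apply: eq_integral => s _; rewrite patchE; case: ifPn => //.
by rewrite notin_setE/= in_itv/= => /negP /h0 ->.
Qed.

Lemma cell_integrable_conv {R : realType} (a b t x y : R) : 0 < a -> 0 < b ->
  cell_integrable x y (fun s => pomega a (t - s) * pomega b s).
Proof.
move=> a0 b0; apply: (@integrableS _ _ _ _ setT) => //.
apply/integrableP; split; first exact: measurable_pomega_conv.
rewrite [X in (X < _)%E](_ : _ = (pomega (a + b) t)%:E) ?ltry//.
rewrite -pomega_conv//; apply: eq_integral => s _ /=.
by rewrite ger0_norm// mulr_ge0 ?pomega_ge0.
Qed.

Lemma cell_int_conv {R : realType} (a b t : R) : 0 < a -> 0 < b ->
  cell_int 0 t (fun s => pomega a (t - s) * pomega b s) = pomega (a + b) t.
Proof.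
move=> a0 b0; rewrite cell_int_fine ?pomega_conv// => s.
rewrite negb_and -!leNgt => /orP[s0|ts].
  by rewrite (pomega_npos b)// mulr0.
by rewrite pomega_npos ?mul0r// subr_le0.
Qed.

Lemma cell_integrable_pomega {R : realType} (b x y : R) : 0 <= x -> 0 < b ->
  cell_integrable x y (pomega b).
Proof.
move=> x0 b0; apply: eq_cell_integrable (cell_integrable_conv 1 b y x y ltr01 b0).
by move=> s /andP[_ sy]; rewrite pomega1 ?mul1r// subr_gt0.
Qed.

(** Convolution with [omega_1], which is the constant 1, is integration.  *)
Lemma cell_int_pomega {R : realType} (b x y : R) : 0 < b -> 0 <= x -> x <= y ->
  cell_int x y (pomega b) = pomega (1 + b) y - pomega (1 + b) x.
Proof.
move=> b0 x0 xy.
have E z : cell_int 0 z (pomega b) = pomega (1 + b) z.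
  rewrite -cell_int_conv//; apply: eq_cell_int => s /andP[_ sz].
  by rewrite pomega1 ?mul1r// subr_gt0.
have := cell_int_split 0 x y (pomega b) x0 xy.
by rewrite !E => ->; [rewrite addrC addKr|exact: cell_integrable_pomega].
Qed.

Lemma cell_integrable_pomega_refl {R : realType} (a t x y : R) :
  0 < a -> 0 <= x -> cell_integrable x y (fun s => pomega a (t - s)).
Proof.
move=> a0 x0; apply: eq_cell_integrable (cell_integrable_conv a 1 t x y a0 ltr01).
by move=> s /andP[xs _]; rewrite pomega1 ?mulr1// (le_lt_trans x0).
Qed.

(** After shifting by [x] this is the convolution of [omega_a] and [omega_1]
    at [t - x].  *)
Lemma cell_int_pomega_refl {R : realType} (a t x : R) : 0 < a ->
  cell_int x t (fun s => pomega a (t - s)) = pomega (1 + a) (t - x).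
Proof.
move=> a0.
rewrite (eq_cell_int _ _ _ (fun s => pomega a (t - s) * pomega 1 (s - x))); last first.
  by move=> s /andP[xs _]; rewrite pomega1 ?mulr1// subr_gt0.
rewrite cell_int_fine => [|s]; last first.
  rewrite negb_and -!leNgt => /orP[sx|ts].
    by rewrite (pomega_npos 1) ?mulr0// subr_le0.
  by rewrite pomega_npos ?mul0r// subr_le0.
transitivity (fine (pomega (a + 1) (t - x))%:E); last by rewrite [a + 1]addrC.
apply: (congr1 fine); rewrite -(pomega_conv a 1 (t - x) a0 ltr01).
rewrite (ge0_integral_affine 1 x)//; last 2 first.
- apply/measurable_EFinP; apply: measurable_funM.
    apply: (measurableT_comp (measurable_pomega a) (g := fun s : R => t - s)).
    exact: measurable_funB.
  apply: (measurableT_comp (measurable_pomega 1) (g := fun s : R => s - x)).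
  exact: measurable_funB.
- by move=> s; rewrite lee_fin mulr_ge0 ?pomega_ge0.
rewrite mul1e; apply: eq_integral => s _.
by rewrite mul1r addrK opprD addrA addrAC.
Qed.

(** The endpoints are negligible, and inside the cell the argument [t - s] is
    positive, where the truncation does nothing.  *)
Lemma closed_int_omega {R : realType} (a t x y : R) : y <= t ->
  \int[@lebesgue_measure R]_(s in `[x, y]) omega a (t - s)
  = cell_int x y (fun s => pomega a (t - s)).
Proof.
move=> yt; rewrite /cell_int /Rintegral; congr fine.
rewrite integral_itv_bndoo; last first.
  apply: measurable_funTS; apply/measurable_EFinP.
  apply: (measurableT_comp (f := omega a) (g := fun s : R => t - s)).
    by apply: measurable_funM => //; apply: (measurable_powR (R := R)).
  exact: measurable_funB.
apply: eq_integral => s; rewrite inE/= in_itv/= => /andP[_ sy].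
by rewrite pomegaE// subr_gt0 (lt_le_trans sy).
Qed.

Lemma pomega_ler {R : realType} (b s u : R) :
  1 <= b -> s <= u -> pomega b s <= pomega b u.
Proof.
move=> b1 su; have b0 : 0 < b by rewrite (lt_le_trans ltr01).
case: (ltP 0 s) => s0; last by rewrite (pomega_npos b s)// pomega_ge0.
have u0 : 0 < u by rewrite (lt_le_trans s0).
rewrite /pomega !ppow_pos// ler_pM2r ?invr_gt0 ?Gamma_gt0//.
by rewrite ge0_ler_powR ?nnegrE ?subr_ge0// ltW.
Qed.

Lemma pomega_nler {R : realType} (b s u : R) : 0 < b ->
  b <= 1 -> 0 < s -> s <= u -> pomega b u <= pomega b s.
Proof.
move=> b0 b1 s0 su; have u0 : 0 < u by rewrite (lt_le_trans s0).
rewrite /pomega !ppow_pos// ler_pM2r ?invr_gt0 ?Gamma_gt0//.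
rewrite -[b - 1]opprB !powRN lef_pV2 ?posrE ?powR_gt0//.
by rewrite ge0_ler_powR ?nnegrE ?subr_ge0// ltW.
Qed.

(** The singular range [b <= 1]: [omega_b] may be unbounded near 0, so it cannot
    be replaced by a value on the cell, but it is decreasing while the other
    factor is increasing, and Chebyshev's inequality replaces it by its mean.  *)
Lemma cell_conv_le_decr {R : realType} (a b t x y : R) :
  0 < a -> a <= 1 -> 0 < b -> b <= 1 -> 0 <= x -> x <= y -> y <= t ->
  (y - x) * cell_int x y (fun s => pomega a (t - s) * pomega b s)
  <= cell_int x y (fun s => pomega a (t - s))
     * (pomega (1 + b) y - pomega (1 + b) x).
Proof.
move=> a0 a1 b0 b1 x0 xy yt; rewrite -cell_int_pomega//.
apply: chebyshev_cell => //.
- move=> s u; rewrite !in_itv/= => /andP[xs sy] /andP[xu uy] su.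
  by apply: pomega_nler => //; lra.
- move=> s u; rewrite !in_itv/= => /andP[xs sy] /andP[xu uy] su.
  by apply: pomega_nler => //; lra.
- exact: cell_integrable_pomega_refl.
- exact: cell_integrable_pomega.
- exact: cell_integrable_conv.
Qed.

(** The range [b >= 1], where the value at the right end is the maximum.  *)
Lemma cell_conv_le_incr {R : realType} (a b t x y : R) :
  0 < a -> 1 <= b -> 0 <= x ->
  cell_int x y (fun s => pomega a (t - s) * pomega b s)
  <= cell_int x y (fun s => pomega a (t - s)) * pomega b y.
Proof.
move=> a0 b1 x0; have b0 : 0 < b by lra.
rewrite [leRHS]mulrC -cell_intZ; last exact: cell_integrable_pomega_refl.
apply: le_cell_int.
- exact: cell_integrable_conv.
- by apply: cell_integrableZ; exact: cell_integrable_pomega_refl.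
move=> s /andP[_ /ltW sy]; rewrite [leRHS]mulrC; apply: ler_wpM2l.
  exact: pomega_ge0.
exact: pomega_ler.
Qed.

(** For [b >= 1] the value at the left end is controlled by the increment of the
    primitive over the cell to its right.  *)
Lemma step_pomega_le {R : realType} (b x y : R) :
  1 <= b -> 0 <= x -> x <= y ->
  (y - x) * pomega b x <= pomega (1 + b) y - pomega (1 + b) x.
Proof.
move=> b1 x0 xy; have b0 : 0 < b by lra.
rewrite -cell_int_pomega// [leLHS]mulrC -(cell_int_cst _ _ _ xy).
apply: le_cell_int; [exact: cell_integrable_cst|exact: cell_integrable_pomega|].
by move=> s /andP[/ltW xs _]; exact: pomega_ler.
Qed.

(** * Complementary discrete kernels *)

(** Restricting the context to comparisons of natural numbers keeps [lia]
    fast in proofs with many hypotheses about reals.  *)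
Ltac nat_lia :=
  repeat match goal with
  | H : ?T |- _ =>
    lazymatch T with
    | is_true (leq _ _) => fail
    | is_true (andb (leq _ _) (leq _ _)) => fail
    | _ => clear H
    end
  end; lia.

Definition monotone_kernels {R : realType} (N : nat) (A : nat -> nat -> R) :=
  forall n : nat, (1 <= n <= N)%N ->
     (forall j : nat, (j.+1 <= n.-1)%N -> A n j.+1 <= A n j)
     /\ 0 < A n n.-1.

Lemma kernel_gt0 {R : realType} (N : nat) (A : nat -> nat -> R) (n j : nat) :
  monotone_kernels N A -> (1 <= n <= N)%N -> (j <= n.-1)%N -> 0 < A n j.
Proof.
move=> hA nN jn; have [mono pos] := hA n nN.
rewrite -(subKn jn); elim: (n.-1 - j)%N => [|i IH]; first by rewrite subn0.
have [ile|ige] := leqP n.-1 i.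
  by move: IH; rewrite (_ : n.-1 - i.+1 = n.-1 - i)%N//; lia.
apply: lt_le_trans IH _; rewrite (_ : n.-1 - i = (n.-1 - i.+1).+1)%N; last by lia.
by apply: mono; lia.
Qed.

Lemma compl_kernel_ge0 {R : realType} (N : nat) (A : nat -> nat -> R) (n j : nat) :
  monotone_kernels N A -> (1 <= n <= N)%N -> (j <= n.-1)%N ->
  0 <= compl_kernel A n j.
Proof.
move=> hA nN; elim/ltn_ind: j => -[_ _|j IH jn].
  by rewrite compl_kernel0 div1r invr_ge0 ltW// (kernel_gt0 N).
rewrite compl_kernel_rec// mulr_ge0//.
  by rewrite div1r invr_ge0 ltW// (kernel_gt0 N)//; lia.
rewrite big_nat_cond sumr_ge0// => k; rewrite andbT => /andP[_ kj].
rewrite mulr_ge0 ?IH//; last by lia.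
have [mono _] := hA (n - k)%N ltac:(lia).
have := mono (j.+1 - k - 1)%N ltac:(lia).
by rewrite subr_ge0 (_ : (j.+1 - k - 1).+1 = j.+1 - k)%N//; lia.
Qed.

(** The sums for [d] and [d.+1] differ by exactly what the recursion defining
    the next kernel sets to 0.  *)
Lemma compl_kernel_sum {R : realType} (A : nat -> nat -> R) (n d : nat) :
  (forall i, (i <= d)%N -> A (n - i)%N 0%N != 0) ->
  \sum_(0 <= i < d.+1) compl_kernel A n i * A (n - i)%N (d - i)%N = 1.
Proof.
elim: d => [|d IH] A0.
  by rewrite big_nat1 compl_kernel0 subn0 div1r mulVf// -[n]subn0 A0.
rewrite big_nat_recr//= subnn compl_kernel_rec//.
have Ad : A (n - d.+1)%N 0%N != 0 by exact: A0.
rewrite div1r mulrAC mulVf// mul1r -big_split/=.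
rewrite -[RHS]IH => [|i id]; last by apply: A0; lia.
apply: eq_big_nat => i /andP[_ id].
rewrite (_ : d.+1 - i - 1 = d - i)%N; last by lia.
by ring.
Qed.

(** Exchanging the sums, the coefficient of [x k] is the convolution of the two
    kernels, which equals 1.  *)
Lemma compl_kernel_inverse {R : realType} (N : nat) (A : nat -> nat -> R)
    (n : nat) (x : nat -> R) :
  monotone_kernels N A -> (1 <= n <= N)%N ->
  \sum_(1 <= j < n.+1) compl_kernel A n (n - j)
     * (\sum_(1 <= k < j.+1) A j (j - k)%N * x k)
  = \sum_(1 <= k < n.+1) x k.
Proof.
move=> hA nN.
under eq_big_nat => j jn.
  rewrite (big_nat_widen _ _ n.+1)/=; last by lia.
  rewrite big_distrr/=; over.
rewrite (exchange_big_dep_nat predT)//=; apply: eq_big_nat => k kn.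
under eq_bigr do rewrite mulrA.
rewrite -big_distrl/= -[RHS]mul1r; congr (_ * _).
rewrite -[RHS](compl_kernel_sum A n (n - k)) => [|i ik]; last first.
  by rewrite gt_eqF// (kernel_gt0 N)//; lia.
transitivity (\sum_(k <= i < n.+1) compl_kernel A n (n - i) * A i (i - k)%N).
  rewrite [RHS](big_nat_widenl _ 1); last by lia.
  by apply: eq_bigl => i; rewrite ltnS.
rewrite -{1}[k]add0n big_addn big_nat_rev/= add0n subSn; last by lia.
apply: eq_big_nat => i ik; congr (compl_kernel _ _ _ * A _ _); lia.
Qed.

(** Setting [x n] to 0 in the inversion formula, the term [j = n] that is left
    out here is nonnegative.  *)
Lemma compl_kernel_inverse_le {R : realType} (N : nat) (A : nat -> nat -> R)
    (n : nat) (x : nat -> R) :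
  monotone_kernels N A -> (1 <= n <= N)%N ->
  (forall k, (1 <= k < n)%N -> 0 <= x k) ->
  \sum_(1 <= j < n) compl_kernel A n (n - j)
     * (\sum_(1 <= k < j.+1) A j (j - k)%N * x k)
  <= \sum_(1 <= k < n) x k.
Proof.
move=> hA nN x0.
pose y k := if (k < n)%N then x k else 0.
have -> : \sum_(1 <= k < n) x k = \sum_(1 <= k < n.+1) y k.
  rewrite big_nat_recr/=; last by lia.
  rewrite {2}/y ltnn addr0; apply: eq_big_nat => k /andP[_ kn].
  by rewrite /y kn.
rewrite -(compl_kernel_inverse N A n y)// big_nat_recr/=; last by lia.
rewrite -[leLHS]addr0 lerD//.
  rewrite le_eqVlt; apply/orP; left; apply/eqP; apply: eq_big_nat => j jn.
  congr (_ * _); apply: eq_big_nat => k kj; rewrite /y ifT//; lia.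
rewrite mulr_ge0 ?(compl_kernel_ge0 N)//; first by lia.
rewrite big_nat_cond sumr_ge0// => k; rewrite andbT => kn.
rewrite mulr_ge0//.
  by rewrite ltW// (kernel_gt0 N)//; lia.
by rewrite /y; case: ifP => // kn'; rewrite x0//; lia.
Qed.

(** * Complementary kernels against fractional powers *)

Definition increasing_mesh {R : realType} (N : nat) (t : nat -> R) :=
  t 0%N = 0 /\ forall n : nat, (1 <= n <= N)%N -> t n.-1 < t n.

Definition kernels_bounded_below {R : realType} (alpha : R) (N : nat)
    (t : nat -> R) (A : nat -> nat -> R) (piA : R) :=
  forall n k : nat, (1 <= k <= n)%N -> (n <= N)%N ->
     1 / (piA * step t k) *
       (\int[@lebesgue_measure R]_(s in `[t k.-1, t k])
          omega (1 - alpha) (t n - s))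
     <= A n (n - k)%N.

Lemma mesh_le {R : realType} (N : nat) (t : nat -> R) (i j : nat) :
  increasing_mesh N t -> (i <= j <= N)%N -> t i <= t j.
Proof.
move=> [_ tS]; elim: j => [|j IH] ijN; first by rewrite (_ : i = 0%N)//; nat_lia.
have [->//|ij] := eqVneq i j.+1.
by apply: le_trans (IH _) (ltW (tS j.+1 _)); lia.
Qed.

Lemma mesh_ge0 {R : realType} (N : nat) (t : nat -> R) (i : nat) :
  increasing_mesh N t -> (i <= N)%N -> 0 <= t i.
Proof. by move=> ht iN; have [<- _] := ht; apply: (mesh_le N). Qed.

Lemma step_gt0 {R : realType} (N : nat) (t : nat -> R) (k : nat) :
  increasing_mesh N t -> (1 <= k <= N)%N -> 0 < step t k.
Proof. by move=> [_ tS] kN; rewrite subr_gt0 tS. Qed.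

Lemma cell_int_kernel_le {R : realType} (alpha : R) (N : nat) (t : nat -> R)
    (A : nat -> nat -> R) (piA : R) (n k : nat) :
  increasing_mesh N t -> 0 < piA -> kernels_bounded_below alpha N t A piA ->
  (1 <= k <= n)%N -> (n <= N)%N ->
  cell_int (t k.-1) (t k) (fun s => pomega (1 - alpha) (t n - s))
  <= piA * step t k * A n (n - k)%N.
Proof.
move=> ht piA0 hA kn nN.
have tk0 : 0 < step t k by apply: (step_gt0 N) => //; nat_lia.
have := hA n k kn nN.
rewrite closed_int_omega; last by apply: (mesh_le N) => //; nat_lia.
by rewrite mul1r mulrC ler_pdivrMr ?mulr_gt0// [_ * A _ _]mulrC.
Qed.

(** The convolution at [t j], cut at the mesh points.  *)
Lemma pomega_sum_cells {R : realType} (N : nat) (t : nat -> R) (a b : R) (j : nat) :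
  increasing_mesh N t -> 0 < a -> 0 < b -> (j <= N)%N ->
  pomega (a + b) (t j) = \sum_(1 <= k < j.+1)
    cell_int (t k.-1) (t k) (fun s => pomega a (t j - s) * pomega b s).
Proof.
move=> ht a0 b0 jN; rewrite -cell_int_conv//.
set h := fun s => _; have hI x y : cell_integrable x y h.
  exact: cell_integrable_conv.
have [t0 _] := ht.
suff H i : (i <= j)%N -> cell_int 0 (t i) h =
    \sum_(1 <= k < i.+1) cell_int (t k.-1) (t k) h by exact: H.
elim: i => [_|i IH ij].
  by rewrite big_geq// t0 /cell_int set_itvoo0 Rintegral_set0.
rewrite big_nat_recr//= -IH; last exact: ltnW.
apply: cell_int_split => //.
- by apply: (mesh_ge0 N) => //; nat_lia.
- by apply: (mesh_le N) => //; nat_lia.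
Qed.

(** It suffices to bound each cell integral by [piA * max 1 rho] times
    [A j (j - k) * x k], for nonnegative [x] whose sum over [k < n] is at most
    [omega_(1+b) (t n)], and to sum by inverting the kernels.  For [b <= 1], [x k] is
    the increment of [omega_(1+b)] over the cell [k]; for [b > 1] it is the
    increment over the next cell, which is available because [j < n].  *)
Lemma compl_kernel_sum_pomega {R : realType} (alpha : R) (N : nat)
    (t : nat -> R) (A : nat -> nat -> R) (piA rho b : R) (n : nat) :
  0 < alpha < 1 -> increasing_mesh N t -> monotone_kernels N A ->
  0 < piA -> kernels_bounded_below alpha N t A piA -> 0 < rho ->
  (forall k : nat, (1 <= k <= N.-1)%N -> step t k / step t k.+1 <= rho) ->
  0 < b -> (1 <= n <= N)%N ->
  \sum_(1 <= j < n) compl_kernel A n (n - j) * pomega (1 - alpha + b) (t j)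
  <= piA * Num.max 1 rho * pomega (1 + b) (t n).
Proof.
move=> /andP[al0 al1] ht hA piA0 hAt rho0 hrho b0 nN.
have a0 : 0 < 1 - alpha by lra.
have [t0 _] := ht.
pose M := Num.max 1 rho; pose Q i := pomega (1 + b) (t i).
have M1 : 1 <= M by rewrite le_max lexx.
have Mrho : rho <= M by rewrite le_max lexx orbT.
have M0 : 0 < M by lra.
have b10 : 0 < 1 + b by lra.
have Q0 i : 0 <= Q i by exact: pomega_ge0.
have Q00 : Q 0%N = 0 by rewrite /Q t0 pomega_npos.
have QS i : (i < N)%N -> Q i <= Q i.+1.
  by move=> iN; apply: pomega_ler; [lra|apply: (mesh_le N) => //; nat_lia].
have QP i : (1 <= i <= N)%N -> Q i.-1 <= Q i.
  by case: i => // i iN; apply: QS; nat_lia.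
have A_ge0 j k : (1 <= k <= j)%N -> (j < n)%N -> 0 <= A j (j - k)%N.
  by move=> kj jn; rewrite ltW// (kernel_gt0 N)//; nat_lia.
suff [x [x0 sx cx]] : exists x : nat -> R,
    [/\ forall k, (1 <= k < n)%N -> 0 <= x k, \sum_(1 <= k < n) x k <= Q n
      & forall j k, (1 <= k <= j)%N -> (j < n)%N ->
          cell_int (t k.-1) (t k)
            (fun s => pomega (1 - alpha) (t j - s) * pomega b s)
          <= piA * M * (A j (j - k)%N * x k)].
  apply: (@le_trans _ _ (piA * M * \sum_(1 <= k < n) x k)); last first.
    by rewrite ler_wpM2l// mulr_ge0 ?ltW.
  apply: le_trans (ler_wpM2l _ (compl_kernel_inverse_le N A n x hA nN x0)); last first.
    by rewrite mulr_ge0 ?ltW.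
  rewrite mulr_sumr; apply: ler_sum_nat => j jn.
  rewrite [leRHS]mulrCA ler_wpM2l ?(compl_kernel_ge0 N)//; first by nat_lia.
  rewrite (pomega_sum_cells N)//; last by nat_lia.
  by rewrite mulr_sumr; apply: ler_sum_nat => k kj; apply: cx; nat_lia.
(* The monotonicity of [omega_b] changes at [b = 1]. *)
case: (leP b 1) => b1.
  exists (fun k => Q k - Q k.-1); split.
  - by move=> k kn; rewrite subr_ge0; apply: QP; nat_lia.
  - pose F k := Q k.-1; rewrite -[leLHS]/(\sum_(1 <= k < n) (F k.+1 - F k)).
    rewrite telescope_sumr; last by nat_lia.
    by rewrite /F /= Q00 subr0; apply: QP.
  - move=> j k kj jn.
    have sk : 0 < step t k by apply: (step_gt0 N) => //; nat_lia.
    have := cell_conv_le_decr (1 - alpha) b (t j) (t k.-1) (t k) a0 _ b0 b1 _ _ _.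
    have := cell_int_kernel_le _ _ _ _ _ j k ht piA0 hAt kj _.
    rewrite -/(step t k) -/(Q k) -/(Q k.-1).
    set I := cell_int _ _ (fun s => _ * _); set J := cell_int _ _ _.
    move=> /(_ ltac:(nat_lia)) HJ HI.
    have dQ : 0 <= Q k - Q k.-1.
      by rewrite subr_ge0; apply: QP; nat_lia.
    have {}HI : step t k * I <= J * (Q k - Q k.-1).
      apply: HI; [lra| | |].
      + by apply: (mesh_ge0 N) => //; nat_lia.
      + by apply: (mesh_le N) => //; nat_lia.
      + by apply: (mesh_le N) => //; nat_lia.
    have : step t k * I <= step t k * (piA * (A j (j - k)%N * (Q k - Q k.-1))).
      apply: le_trans HI _; apply: le_trans (ler_wpM2r dQ HJ) _.
      by rewrite le_eqVlt; apply/orP; left; apply/eqP; ring.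
    rewrite ler_pM2l// => HH; apply: le_trans HH _.
    rewrite ler_wpM2r ?mulr_ge0 ?A_ge0//.
    by rewrite ler_peMr// ltW.
exists (fun k => Q k.+1 - Q k); split.
- by move=> k kn; rewrite subr_ge0; apply: QS; nat_lia.
- rewrite telescope_sumr; last by nat_lia.
  by rewrite gerBl.
- move=> j k kj jn.
  have := cell_conv_le_incr (1 - alpha) b (t j) (t k.-1) (t k) a0 (ltW b1) _.
  have := cell_int_kernel_le _ _ _ _ _ j k ht piA0 hAt kj _.
  have := step_pomega_le b (t k) (t k.+1) (ltW b1) _ _.
  rewrite -/(step t k.+1) -/(Q k) -/(Q k.+1).
  set I := cell_int _ _ (fun s => _ * _); set J := cell_int _ _ _.
  set q := pomega b (t k).
  move=> HQ /(_ ltac:(nat_lia)) HJ HI.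
  have {}HQ : step t k.+1 * q <= Q k.+1 - Q k.
    by apply: HQ; [apply: (mesh_ge0 N)|apply: (mesh_le N)] => //; nat_lia.
  have {}HI : I <= J * q by apply: HI; apply: (mesh_ge0 N) => //; nat_lia.
  have q0 : 0 <= q by exact: pomega_ge0.
  have Ajk := A_ge0 j k kj jn.
  have hk : step t k <= rho * step t k.+1.
    rewrite -ler_pdivrMr; first by apply: hrho; nat_lia.
    by apply: (step_gt0 N) => //; nat_lia.
  apply: le_trans HI _; apply: le_trans (ler_wpM2r q0 HJ) _.
  have -> : piA * step t k * A j (j - k)%N * q = piA * A j (j - k)%N * (step t k * q).
    by ring.
  have -> : piA * M * (A j (j - k)%N * (Q k.+1 - Q k)) =
            piA * A j (j - k)%N * (M * (Q k.+1 - Q k)) by ring.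
  rewrite ler_wpM2l//; first by rewrite mulr_ge0// ltW.
  apply: le_trans (ler_wpM2r q0 hk) _; rewrite -mulrA.
  apply: ler_pM => //; first exact: ltW.
  by rewrite mulr_ge0// ltW// (step_gt0 N)//; nat_lia.
Qed.

(** For [k = n] the lower bound on the kernels is explicit, since the cell
    integral is [omega_(2-alpha)] at the step size.  *)
Lemma compl_kernel0_le {R : realType} (alpha : R) (N : nat) (t : nat -> R)
    (A : nat -> nat -> R) (piA : R) (n : nat) :
  0 < alpha < 1 -> increasing_mesh N t -> 0 < piA ->
  kernels_bounded_below alpha N t A piA -> (1 <= n <= N)%N ->
  compl_kernel A n 0 <= piA * Gamma (2 - alpha) * step t n `^ alpha.
Proof.
move=> /andP[al0 al1] ht piA0 hAt nN.
have a0 : 0 < 1 - alpha by lra.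
have sn := step_gt0 N t n ht nN.
have G0 : 0 < Gamma (2 - alpha) by apply: Gamma_gt0; lra.
have := cell_int_kernel_le alpha N t A piA n n ht piA0 hAt ltac:(nat_lia) ltac:(nat_lia).
rewrite subnn cell_int_pomega_refl// -/(step t n) /pomega ppow_pos//.
have -> : 1 + (1 - alpha) = 2 - alpha by ring.
have -> : 2 - alpha - 1 = 1 - alpha by ring.
rewrite powRB ?gt_eqF ?implybT// (powRr1 (ltW sn)).
have sa : 0 < step t n `^ alpha by exact: powR_gt0.
move: sa G0; set sa := _ `^ _; set G := Gamma _ => sa0 G0 HA.
have A0 : 1 <= piA * A n 0%N * G * sa.
  move: HA; rewrite ler_pdivrMr// ler_pdivrMr// => HA.
  rewrite -(ler_pM2l sn) mulr1; apply: le_trans HA _.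
  by rewrite le_eqVlt; apply/orP; left; apply/eqP; ring.
have An : 0 < A n 0%N.
  rewrite ltNge; apply/negP => An; move: A0; rewrite leNgt => /negP; apply.
  apply: le_lt_trans ltr01; rewrite (_ : _ * sa = piA * G * sa * A n 0%N); last by ring.
  by rewrite mulr_ge0_le0// !mulr_ge0// ltW.
rewrite compl_kernel0 ler_pdivrMr//; apply: le_trans A0 _.
by rewrite le_eqVlt; apply/orP; left; apply/eqP; ring.
Qed.

(** * The Mittag-Leffler function *)

Definition ml_term {R : realType} (alpha z : R) (k : nat) : R :=
  z ^+ k / Gamma (1 + k%:R * alpha).

Lemma ml_term_ge0 {R : realType} (alpha z : R) (k : nat) :
  0 < alpha -> 0 <= z -> 0 <= ml_term alpha z k.
Proof.
move=> al0 z0; rewrite mulr_ge0 ?exprn_ge0// invr_ge0 ltW// Gamma_gt0//.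
by rewrite ltr_wpDr// mulr_ge0// ltW.
Qed.

(** Choosing [M] with [M ^ alpha = 2 * z + 1] in the lower bound on [Gamma]
    dominates the terms by a geometric series of ratio 1/2.  *)
Lemma cvg_ml_series {R : realType} (alpha z : R) :
  0 < alpha -> 0 <= z -> cvgn (series (ml_term alpha z)).
Proof.
(* Adding 1 keeps [y], and hence [M], positive when [z = 0]. *)
move=> al0 z0; pose y := 2 * z + 1; pose M := y `^ alpha^-1.
have y0 : 0 < y by rewrite /y; lra.
have M0 : 0 < M by exact: powR_gt0.
have yE k : M `^ (k%:R * alpha) = y ^+ k.
  rewrite -powRrM mulrCA mulVf ?gt_eqF// mulr1 powR_mulrn//; exact: ltW.
apply: (@series_le_cvg _ _ (geometric (expR M) 2^-1)).
- by move=> k; exact: ml_term_ge0.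
- by move=> k; rewrite /= mulr_ge0 ?expR_ge0// exprn_ge0// invr_ge0.
- move=> k; rewrite /ml_term /=.
  have k0 : 0 <= k%:R * alpha by rewrite mulr_ge0// ltW.
  have := Gamma_ge (k%:R * alpha) M k0 M0; rewrite yE expRN.
  set G := Gamma _ => HG.
  have eM : 0 < expR M by exact: expR_gt0.
  have yk : 0 < y ^+ k by rewrite exprn_gt0.
  have G0 : 0 < G by apply: lt_le_trans HG; rewrite divr_gt0.
  rewrite ler_pdivrMr// exprVn mulrAC ler_pdivlMr ?exprn_gt0//.
  rewrite ler_pdivrMr// [G * _]mulrC in HG; apply: le_trans HG.
  by rewrite -exprMn lerXn2r ?nnegrE ?mulr_ge0 ?(ltW y0)// /y; lra.
- apply: is_cvg_geometric_series; rewrite ger0_norm ?invr_ge0//.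
  by rewrite invf_lt1 ?ltr1n.
Qed.

Lemma ml_series_le {R : realType} (alpha z : R) (n : nat) :
  0 < alpha -> 0 <= z -> series (ml_term alpha z) n <= mittag_leffler alpha z.
Proof.
move=> al0 z0; apply: nondecreasing_cvgn_le; last exact: cvg_ml_series.
by apply: nondecreasing_series => k _ _; exact: ml_term_ge0.
Qed.

Lemma mittag_leffler_ge1 {R : realType} (alpha z : R) :
  0 < alpha -> 0 <= z -> 1 <= mittag_leffler alpha z.
Proof.
move=> al0 z0; apply: le_trans (ml_series_le alpha z 1 al0 z0).
by rewrite /series/= big_nat1 /ml_term expr0 mul0r addr0 Gamma1 divr1.
Qed.

Lemma le_mittag_leffler {R : realType} (alpha z w : R) :
  0 < alpha -> 0 <= z -> z <= w -> mittag_leffler alpha z <= mittag_leffler alpha w.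
Proof.
move=> al0 z0 zw; have w0 := le_trans z0 zw.
apply: lim_series_le; [exact: cvg_ml_series|exact: cvg_ml_series|].
move=> k; rewrite ler_wpM2r ?lerXn2r ?nnegrE// invr_ge0 ltW// Gamma_gt0//.
by rewrite ltr_wpDr// mulr_ge0// ltW.
Qed.

(** The terms of the series are fractional powers, so that the bound on the
    complementary kernels applies to each of them.  *)
Lemma ml_termE {R : realType} (alpha mu x : R) (k : nat) : 0 < x ->
  ml_term alpha (mu * x `^ alpha) k = mu ^+ k * pomega (1 + k%:R * alpha) x.
Proof.
move=> x0; rewrite /ml_term /pomega ppow_pos// mulrA exprMn; congr (_ * _ / _).
rewrite -powR_mulrn ?powR_ge0// -powRrM.
by rewrite [1 + _]addrC addrK mulrC.
Qed.

Lemma sum_limn_le {R : realType} (s : seq nat) (w : nat -> R)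
    (f : nat -> nat -> R) (B : R) :
  (forall j, j \in s -> cvgn (f j)) ->
  (forall K, \sum_(j <- s) w j * f j K <= B) ->
  \sum_(j <- s) w j * limn (f j) <= B.
Proof.
move=> fc fB.
have cv : (fun K => \sum_(j <- s) w j * f j K) @ \oo -->
          \sum_(j <- s) w j * limn (f j).
  elim: s fc {fB} => [_|j s IH fc].
    rewrite big_nil; under eq_fun do rewrite big_nil; exact: cvg_cst.
  rewrite big_cons; under eq_fun do rewrite big_cons.
  apply: cvgD; last by apply: IH => i si; apply: fc; rewrite inE si orbT.
  by apply: cvgM; [exact: cvg_cst|apply: fc; rewrite inE eqxx].
by rewrite -(cvg_lim _ cv)//; apply: limr_le; [apply/cvg_ex; eexists; exact: cv|exact: nearW].
Qed.

(** The complementary kernels send the term of index [i] of the series at [t j]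
    below the term of index [i.+1] at [t n], which leaves out the term of index 0,
    equal to 1.  *)
Lemma compl_kernel_sum_ml {R : realType} (alpha : R) (N : nat)
    (t : nat -> R) (A : nat -> nat -> R) (piA rho Lambda : R) (n : nat) :
  0 < alpha < 1 -> increasing_mesh N t -> monotone_kernels N A ->
  0 < piA -> kernels_bounded_below alpha N t A piA -> 0 < rho ->
  (forall k : nat, (1 <= k <= N.-1)%N -> step t k / step t k.+1 <= rho) ->
  0 <= Lambda -> (1 <= n <= N)%N ->
  let E j := mittag_leffler alpha
               (2 * Num.max 1 rho * piA * Lambda * t j `^ alpha) in
  \sum_(1 <= j < n) compl_kernel A n (n - j) * (2 * Lambda) * E j <= E n - 1.
Proof.
move=> al ht hA piA0 hAt rho0 hrho L0 nN /=.
have /andP[al0 al1] := al.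
set M := Num.max 1 rho; set mu := 2 * M * piA * Lambda.
have M1 : 1 <= M by rewrite le_max lexx.
have M0 : 0 <= M by lra.
have mu0 : 0 <= mu by rewrite /mu !mulr_ge0// ltW.
have tpos j : (1 <= j <= N)%N -> 0 < t j.
  move=> jN; have := step_gt0 N t j ht jN; rewrite /step => h.
  have := mesh_ge0 N t j.-1 ht ltac:(nat_lia); lra.
have z0 j : 0 <= mu * t j `^ alpha by rewrite mulr_ge0 ?powR_ge0.
apply: sum_limn_le => [j _|K]; first exact: cvg_ml_series.
rewrite lerBrDr addrC.
apply: le_trans (ml_series_le alpha _ K.+1 al0 (z0 n)).
rewrite /series/= big_nat_recl//= -[ml_term _ _ 0]/(_ / _).
rewrite expr0 mul0r addr0 Gamma1 divr1 lerD2l.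
under eq_big_nat => j jn do rewrite mulr_sumr.
rewrite exchange_big/=; apply: ler_sum_nat => i _.
under eq_big_nat => j jn.
  rewrite -/(ml_term _ _ _) ml_termE; last by apply: tpos; nat_lia.
  rewrite (_ : _ * _ * _ = mu ^+ i * (2 * Lambda)
     * (compl_kernel A n (n - j) * pomega (1 + i%:R * alpha) (t j))); last by ring.
  over.
rewrite -mulr_sumr -/(ml_term _ _ _) ml_termE; last by apply: tpos.
have b0 : 0 < i.+1%:R * alpha by rewrite mulr_gt0.
have := compl_kernel_sum_pomega alpha N t A piA rho (i.+1%:R * alpha) n
  al ht hA piA0 hAt rho0 hrho b0 nN.
rewrite (_ : 1 - alpha + i.+1%:R * alpha = 1 + i%:R * alpha); last first.
  by rewrite -natr1; ring.
move=> /(ler_wpM2l (_ : 0 <= mu ^+ i * (2 * Lambda))) H.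
apply: le_trans (H _) _; first by rewrite mulr_ge0 ?exprn_ge0// mulr_ge0.
rewrite exprSr -/M le_eqVlt; apply/orP; left; apply/eqP.
by rewrite /mu; ring.
Qed.

Lemma max_1_to_ge {R : realType} (n k : nat) (F : nat -> R) :
  (1 <= k <= n)%N -> F k <= max_1_to n F.
Proof. by move=> kn; apply: le_bigmax_seq => //; rewrite mem_index_iota; lia. Qed.

Lemma max_1_to_le {R : realType} (m n : nat) (F : nat -> R) :
  (m <= n)%N -> max_1_to m F <= max_1_to n F.
Proof. by move=> mn; apply: le_bigmax_nat. Qed.

Lemma max_step_small {R : realType} (alpha c : R) (N n : nat) (t : nat -> R) :
  0 < alpha -> 0 < c -> increasing_mesh N t -> (1 <= n <= N)%N ->
  max_1_to N (step t) <= 1 / c `^ alpha^-1 -> c * step t n `^ alpha <= 1.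
Proof.
move=> al0 c0 ht nN hmax.
have sn := step_gt0 N t n ht nN.
have := le_trans (max_1_to_ge N n (step t) nN) hmax.
have ca : 0 < c `^ alpha^-1 by exact: powR_gt0.
rewrite ler_pdivlMr// => H.
have cE : c = (c `^ alpha^-1) `^ alpha.
  by rewrite -powRrM mulVf ?gt_eqF// powRr1// ltW.
have -> : 1 = 1 `^ alpha :> R by rewrite powR1.
rewrite {1}cE mulrC -powRM ?(ltW sn) ?(ltW ca)//.
by rewrite ge0_ler_powR ?nnegrE ?(ltW al0)// mulr_ge0// ltW.
Qed.

(** * The discrete Gronwall inequality *)

Lemma le_double_mul {R : realType} (e e' x x' : R) :
  1 <= e -> e <= e' -> 0 <= x -> x <= x' -> 2 * e * x <= 2 * e' * x'.
Proof. by move=> e1 ee x0 xx; apply: ler_pM; lra. Qed.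

Lemma le_double_mulr {R : realType} (e x y : R) :
  1 <= e -> 0 <= x -> x <= y -> x <= 2 * e * y.
Proof. by nra. Qed.


Theorem theorem3p1 (R : realType) (alpha : R) (halpha : 0 < alpha < 1)
  (N : nat) (hN : (1 <= N)%N) (T : R) (t : nat -> R)
  (ht0 : t 0%N = 0)
  (ht : forall n : nat, (1 <= n <= N)%N -> t n.-1 < t n)
  (htT : t N = T)
  (A : nat -> nat -> R)
  (hA1 : forall n : nat, (1 <= n <= N)%N ->
     (forall j : nat, (j.+1 <= n.-1)%N -> A n j.+1 <= A n j)
     /\ 0 < A n n.-1)
  (piA : R) (hpiA : 0 < piA)
  (hA2 : forall n k : nat, (1 <= k <= n)%N -> (n <= N)%N ->
     1 / (piA * step t k) *
       (\int[@lebesgue_measure R]_(s in `[t k.-1, t k])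
          omega (1 - alpha) (t n - s))
     <= A n (n - k)%N)
  (rho : R) (hrho : 0 < rho)
  (hA3 : forall k : nat, (1 <= k <= N.-1)%N -> step t k / step t k.+1 <= rho)
  (theta : R) (htheta : 0 <= theta < 1)
  (g : nat -> R) (hg : forall n : nat, (1 <= n <= N)%N -> 0 <= g n)
  (lambda : nat -> R)
  (hlambda : forall l : nat, (l <= N.-1)%N -> 0 <= lambda l)
  (Lambda : R) (hLambda : \sum_(0 <= l < N) lambda l <= Lambda)
  (hstep : Lambda != 0 ->
     max_1_to N (step t)
     <= 1 / (2 * piA * Gamma (2 - alpha) * Lambda) `^ (alpha^-1))
  (v : nat -> R) (hv : forall k : nat, (k <= N)%N -> 0 <= v k)
  (hineq : forall n : nat, (1 <= n <= N)%N ->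
     \sum_(1 <= k < n.+1) A n (n - k)%N * (v k ^+ 2 - v k.-1 ^+ 2)
     <= (\sum_(1 <= k < n.+1) lambda (n - k)%N * offset theta v k ^+ 2)
        + offset theta v n * g n) :
  forall n : nat, (1 <= n <= N)%N ->
    v n <= 2 * mittag_leffler alpha
                 (2 * Num.max 1 rho * piA * Lambda * t n `^ alpha)
             * (v 0%N
                + max_1_to n (fun k : nat =>
                    \sum_(1 <= j < k.+1) compl_kernel A k (k - j)%N * g j)).
Proof.
have /andP[al0 al1] := halpha.
have ht' : increasing_mesh N t by [].
pose M := Num.max 1 rho; pose mu := 2 * M * piA * Lambda.
pose E j := mittag_leffler alpha (mu * t j `^ alpha).
pose p k := \sum_(1 <= j < k.+1) compl_kernel A k (k - j)%N * g j.
pose G k := v 0%N + max_1_to k p.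
have sum_lam j : (j <= N)%N -> \sum_(1 <= k < j.+1) lambda (j - k)%N <= Lambda.
  move=> jN; apply: le_trans hLambda.
  rewrite big_add1/= big_nat_rev/= add0n.
  rewrite (eq_big_nat _ _ (F2 := lambda)) => [|k kj]; last by congr lambda; nat_lia.
  rewrite [leRHS](big_cat_nat _ (n := j))//= lerDl big_nat_cond sumr_ge0// => k.
  by rewrite andbT => kN; apply: hlambda; nat_lia.
have L0 : 0 <= Lambda.
  by have := sum_lam 0%N isT; rewrite big_geq.
have M1 : 1 <= M by rewrite le_max lexx.
have M0 : 0 <= M by lra.
have mu0 : 0 <= mu by rewrite /mu !mulr_ge0// ltW.
have z0 j : 0 <= mu * t j `^ alpha by rewrite mulr_ge0 ?powR_ge0.
have E1 j : 1 <= E j by exact: mittag_leffler_ge1.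
have E_le i j : (i <= j <= N)%N -> E i <= E j.
  move=> ij; apply: le_mittag_leffler => //; rewrite ler_wpM2l//.
  rewrite ge0_ler_powR ?nnegrE ?(ltW al0)//.
  - by apply: (mesh_ge0 N) => //; nat_lia.
  - by apply: (mesh_ge0 N) => //; nat_lia.
  - exact: (mesh_le N).
have p0 k : (1 <= k <= N)%N -> 0 <= p k.
  move=> kN; rewrite /p big_nat_cond sumr_ge0// => j; rewrite andbT => jk.
  by rewrite mulr_ge0 ?(compl_kernel_ge0 N) ?hg//; nat_lia.
have G_le i j : (i <= j)%N -> G i <= G j by move=> ij; rewrite lerD2l max_1_to_le.
have v0G k : (1 <= k <= N)%N -> v 0%N <= G k.
  move=> kN; rewrite lerDl; apply: le_trans (p0 k kN) (max_1_to_ge k k p _); nat_lia.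
have v00 : 0 <= v 0%N by exact: hv.
have EG_le i j : (1 <= i <= j)%N -> (j <= N)%N -> 2 * E i * G i <= 2 * E j * G j.
  move=> ij jN; have Ei := E1 i; have Eij := E_le i j ltac:(nat_lia).
  have Gi := v0G i ltac:(nat_lia); have Gij := G_le i j ltac:(nat_lia).
  by apply: le_double_mul => //; exact: le_trans Gi.
move=> n nN; rewrite -/mu -/(E n) -/(G n).
elim/ltn_ind: n nN => n IH nN.
have vn0 : 0 <= v n by apply: hv; nat_lia.
have En := E1 n; have Gn := v0G n nN.
have IHv0 j : (1 <= j <= N)%N -> v 0%N <= 2 * E j * G n.
  by move=> jN; exact: (le_double_mulr (E j) (v 0%N) (G n) (E1 j) v00 Gn).
have IHv k j : (k <= j)%N -> (1 <= j < n)%N -> v k <= 2 * E j * G n.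
  move=> kj jn; case: k kj => [|k] kj; first by apply: IHv0; nat_lia.
  apply: le_trans (IH k.+1 _ _) _; [by nat_lia|by nat_lia|].
  have Ek := E1 k.+1; have Ekj := E_le k.+1 j ltac:(nat_lia).
  have Gk := v0G k.+1 ltac:(nat_lia); have Gkn := G_le k.+1 n ltac:(nat_lia).
  by apply: le_double_mul => //; exact: le_trans Gk.
(* If some earlier value is at least [v n], its bound is enough. *)
have [/hasP[k] | /hasPn vlt] := boolP (has (fun k => v n <= v k) (iota 0 n)).
  rewrite mem_iota add0n => /andP[_ kn] /le_trans; apply.
  case: k kn => [|k] kn; first exact: IHv0.
  apply: le_trans (IH k.+1 kn _) (EG_le k.+1 n _ _); nat_lia.
have {}vlt k : (k < n)%N -> v k < v n.
  by move=> kn; rewrite ltNge; apply: vlt; rewrite mem_iota.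
have vle k : (k <= n)%N -> v k <= v n.
  by rewrite leq_eqVlt => /predU1P[->//|/vlt/ltW].
have vn : 0 < v n by apply: le_lt_trans v00 (vlt 0%N _); nat_lia.
pose o := offset theta v.
have o0 k : (1 <= k <= n)%N -> 0 <= o k.
  move=> kn; have := hv k ltac:(nat_lia); have := hv k.-1 ltac:(nat_lia).
  by move: htheta => /andP[? ?] ? ?; rewrite /o /offset addr_ge0// mulr_ge0//; lra.
have o_le B k : v k <= B -> v k.-1 <= B -> o k <= B.
  by move: htheta => /andP[? ?] ? ?; rewrite /o /offset; nra.
have o_vn k : (1 <= k <= n)%N -> o k <= v n.
  by move=> kn; apply: o_le; apply: vle; nat_lia.
pose S j := \sum_(1 <= k < j.+1) lambda (j - k)%N * o k.
have S_le j B : (1 <= j <= n)%N -> 0 <= B ->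
    (forall k, (1 <= k <= j)%N -> o k <= B) -> S j <= Lambda * B.
  move=> jn B0 oB; apply: (@le_trans _ _ ((\sum_(1 <= k < j.+1) lambda (j - k)%N) * B)).
    rewrite mulr_suml; apply: ler_sum_nat => k kj.
    by rewrite ler_wpM2l ?oB//; apply: hlambda; nat_lia.
  by rewrite ler_wpM2r// sum_lam//; nat_lia.
have P0 j : (1 <= j <= n)%N -> 0 <= compl_kernel A n (n - j).
  by move=> jn; rewrite (compl_kernel_ge0 N)//; nat_lia.
(* The kernels invert the left-hand sides; then divide by [v n], which
   dominates [v 0] and all the offsets. *)
have key : v n <= v 0%N + p n + \sum_(1 <= j < n.+1) compl_kernel A n (n - j) * S j.
  have : v n ^+ 2 - v 0%N ^+ 2 <=
         v n * (p n + \sum_(1 <= j < n.+1) compl_kernel A n (n - j) * S j).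
    have <- : \sum_(1 <= k < n.+1) (v k ^+ 2 - v k.-1 ^+ 2) = v n ^+ 2 - v 0%N ^+ 2.
      pose F k := v k.-1 ^+ 2.
      rewrite -[LHS]/(\sum_(1 <= k < n.+1) (F k.+1 - F k)).
      by rewrite telescope_sumr.
    rewrite -(compl_kernel_inverse N A n (fun k => v k ^+ 2 - v k.-1 ^+ 2))//.
    rewrite /p -big_split/= mulr_sumr; apply: ler_sum_nat => j jn.
    rewrite -mulrDr mulrCA ler_wpM2l ?P0//.
    apply: le_trans (hineq j _) _; first by nat_lia.
    rewrite addrC mulrDr; apply: lerD.
      by rewrite ler_wpM2r ?hg ?o_vn//; nat_lia.
    rewrite mulr_sumr; apply: ler_sum_nat => k kj.
    rewrite -/(o k) [leRHS]mulrCA ler_wpM2l//; first by apply: hlambda; nat_lia.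
    by rewrite expr2 ler_wpM2r ?o0 ?o_vn//; nat_lia.
  have := vlt 0%N ltac:(nat_lia); set X := p n + _ => v0n HX.
  rewrite -addrA -/X -(ler_pM2l vn); nra.
(* The step size restriction makes the term [j = n] at most [v n / 2]. *)
have absorb : compl_kernel A n 0 * Lambda <= 1 / 2.
  have [->|Ln0] := eqVneq Lambda 0; first by rewrite mulr0; lra.
  have L1 : 0 < Lambda by rewrite lt_neqAle eq_sym Ln0.
  have G0 : 0 < Gamma (2 - alpha) by apply: Gamma_gt0; lra.
  have c0 : 0 < 2 * piA * Gamma (2 - alpha) * Lambda by rewrite !mulr_gt0.
  have H1 := max_step_small alpha _ N n t al0 c0 ht' nN (hstep Ln0).
  have H2 := compl_kernel0_le alpha N t A piA n halpha ht' hpiA hA2 nN.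
  have := ler_wpM2r L0 H2; lra.
have Sn : S n <= Lambda * v n.
  by apply: S_le => //; nat_lia.
have Sj j : (1 <= j < n)%N -> S j <= Lambda * (2 * E j * G n).
  move=> jn; apply: S_le; [by nat_lia| |].
    exact: le_trans v00 (IHv0 j ltac:(nat_lia)).
  by move=> k kj; apply: o_le; apply: IHv; nat_lia.
have := compl_kernel_sum_ml alpha N t A piA rho Lambda n halpha ht' hA1 hpiA
  hA2 hrho hA3 L0 nN.
rewrite /= -/M -/mu -/(E n) => HE.
move: key; rewrite big_nat_recr/=; last by nat_lia.
rewrite subnn => key.
have H1 : \sum_(1 <= j < n) compl_kernel A n (n - j) * S j <= (E n - 1) * G n.
  have G0 : 0 <= G n by lra.
  apply: le_trans (ler_wpM2r G0 HE); rewrite mulr_suml; apply: ler_sum_nat => j jn.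
  rewrite -/(E j) (_ : _ * E j * G n =
    compl_kernel A n (n - j) * (Lambda * (2 * E j * G n))); last by ring.
  by rewrite ler_wpM2l ?P0 ?Sj//; nat_lia.
have H2 : compl_kernel A n 0 * S n <= 1 / 2 * v n.
  have P00 : 0 <= compl_kernel A n 0 by have := P0 n ltac:(nat_lia); rewrite subnn.
  by apply: le_trans (ler_wpM2l P00 Sn) _; rewrite mulrA ler_wpM2r.
have H3 : p n <= max_1_to n p by apply: max_1_to_ge; nat_lia.
have : v n <= G n + (E n - 1) * G n + 1 / 2 * v n by rewrite {1}/G; lra.
lra.
Qed.
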